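(* Let $\mathbf{B}$ be a pointed category with binary products and coproducts, kernels of split epimorphisms and coequalizers of reflexive graphs. The canonical functor $T:Act(\mathbf{B})\to Pt(\mathbf{B})$, $T(X,\xi,B)=(F(X,\xi,B),\overline{[0\ 1]},\sigma\iota_2,B)$, is an equivalence of categories if and only if the following two properties hold in $\mathbf{B}$: (A1) for every object $(X,\xi,B)$ of $Act(\mathbf{B})$, in the diagram $X\xrightarrow{\sigma\iota_1}F(X,\xi,B)\xrightarrow{\overline{[0\ 1]}}B$ (with $\overline{[0\ 1]}$ split by $\sigma\iota_2$), the morphism $\sigma\iota_1$ is the kernel of $\overline{[0\ 1]}$; (A2) the split short five lemma holds: given split epimorphisms $(A,\alpha,\beta,B)$ and $(A',\alpha',\beta',B')$ with kernels $k:X\to A$ of $\alpha$ and $k':X'\to A'$ of $\alpha'$, and morphisms $f:X\to X'$, $h:A\to A'$, $g:B\to B'$ with $hk=k'f$, $\alpha'h=g\alpha$, $h\beta=\beta'g$, if $g$ and $f$ are isomorphisms then $h$ is an isomorphism.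
   Context: A category is pointed if it is enriched in pointed sets: for every pair $X,Y$ of objects there is a specified morphism $0_{X,Y}:X\to Y$ with $0f=0$, $f0=0$ for all $f$ (no zero object assumed). A reflexive graph is a diagram $d,c:C_1\to C_0$, $e:C_0\to C_1$ with $de=1=ce$; $\mathbf{B}$ has coequalizers of reflexive graphs if the coequalizer of $d$ and $c$ exists for each of them. $\iota_1,\iota_2$ are coproduct injections and $[f\ g]$ is the morphism out of a coproduct with components $f,g$. $Pt(\mathbf{B})$: objects $(A,\alpha,\beta,B)$ with $\alpha:A\to B$, $\beta:B\to A$, $\alpha\beta=1_B$ (split epimorphisms); morphisms are pairs $(f_1,f_0)$ with $\alpha'f_1=f_0\alpha$, $f_1\beta=\beta'f_0$. Internal actions. $k:B\flat X\to X\sqcup B$ denotes the chosen kernel of $[0\ 1]:X\sqcup B\to B$. $\eta_X:X\to B\flat X$ is determined by $k\eta_X=\iota_1$, and $\mu_X:B\flat(B\flat X)\to B\flat X$ by $k\mu_X=[k\ \iota_2]k'$, where $k':B\flat(B\flat X)\to(B\flat X)\sqcup B$ is the kernel of $[0\ 1]$. For $g:B\to B'$, $f:X\to X'$, $g\flat f:B\flat X\to B'\flat X'$ is the morphism induced by $f\sqcup g$ on kernels. $Act(\mathbf{B})$: objects are triples $(X,\xi,B)$ with $\xi:B\flat X\to X$, $\xi\eta_X=1$, $\xi\mu_X=\xi(1\flat\xi)$; a morphism $(X,\xi,B)\to(X',\xi',B')$ is a pair $(f:X\to X',g:B\to B')$ with $\xi'(g\flat f)=f\xi$. $F(X,\xi,B)$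 is the coequalizer $\sigma:X\sqcup B\to F(X,\xi,B)$ of $[k\ \iota_2],\ \xi\sqcup 1:(B\flat X)\sqcup B\to X\sqcup B$, and $\overline{[0\ 1]}:F(X,\xi,B)\to B$ is the unique morphism with $\overline{[0\ 1]}\sigma=[0\ 1]$. On morphisms $T(f,g)=(F(f,g),g)$ with $F(f,g)$ induced by $f\sqcup g$. *)

(* Defs.v *)
From Stdlib Require Import Description ProofIrrelevance.

Set Implicit Arguments.
Unset Strict Implicit.
Unset Printing Implicit Defensive.

Record Category := {
  obj :> Type;
  hom : obj -> obj -> Type;
  idm : forall X, hom X X;
  comp : forall X Y Z, hom Y Z -> hom X Y -> hom X Z;
  comp_idl : forall X Y (f : hom X Y), comp (idm Y) f = f;
  comp_idr : forall X Y (f : hom X Y), comp f (idm X) = f;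
  compA : forall W X Y Z (h : hom Y Z) (g : hom X Y) (f : hom W X),
    comp h (comp g f) = comp (comp h g) f
}.
Arguments idm {_} _.
Arguments comp {_ _ _ _} _ _.

Declare Scope cat_scope.
Open Scope cat_scope.
Notation "g ∘ f" := (comp g f) (at level 40, left associativity) : cat_scope.

Definition IsIso (C : Category) (X Y : C) (f : hom X Y) : Prop :=
  exists g : hom Y X, g ∘ f = idm X /\ f ∘ g = idm Y.

Record Functor (C D : Category) := {
  fobj :> C -> D;
  fmap : forall X Y, hom X Y -> hom (fobj X) (fobj Y);
  fmap_id : forall X, fmap (idm X) = idm (fobj X);
  fmap_comp : forall X Y Z (g : hom Y Z) (f : hom X Y),
    fmap (g ∘ f) = fmap g ∘ fmap f
}.
Arguments fmap {_ _} _ {_ _} _.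

Definition idF (C : Category) : Functor C C :=
  {| fobj := fun X => X; fmap := fun X Y f => f;
     fmap_id := fun X => eq_refl; fmap_comp := fun X Y Z g f => eq_refl |}.

Definition compF (C D E : Category) (G : Functor D E) (F : Functor C D) :
  Functor C E.
Proof.
  refine {| fobj := fun X => G (F X); fmap := fun X Y f => fmap G (fmap F f) |}.
  - intros X. now rewrite !fmap_id.
  - intros X Y Z g f. now rewrite !fmap_comp.
Defined.

Definition NaturallyIsomorphic (C D : Category) (F G : Functor C D) : Prop :=
  exists t : forall X, hom (F X) (G X),
    (forall X Y (f : hom X Y), t Y ∘ fmap F f = fmap G f ∘ t X) /\
    (forall X, IsIso (t X)).

Definition IsEquivalence (C D : Category) (F : Functor C D) : Prop :=
  exists G : Functor D C,
    NaturallyIsomorphic (compF G F) (idF C) /\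
    NaturallyIsomorphic (compF F G) (idF D).

Definition IsProduct (C : Category) (X Y P : C) (p1 : hom P X) (p2 : hom P Y) :
  Prop :=
  forall Z (f : hom Z X) (g : hom Z Y),
    exists! h : hom Z P, p1 ∘ h = f /\ p2 ∘ h = g.

Definition IsCoproduct (C : Category) (X Y S : C) (i1 : hom X S) (i2 : hom Y S) :
  Prop :=
  forall Z (f : hom X Z) (g : hom Y Z),
    exists! h : hom S Z, h ∘ i1 = f /\ h ∘ i2 = g.

Definition IsCoequalizer (C : Category) (X Y Q : C) (d c : hom X Y)
  (q : hom Y Q) : Prop :=
  q ∘ d = q ∘ c /\
  forall Z (z : hom Y Z), z ∘ d = z ∘ c -> exists! u : hom Q Z, u ∘ q = z.

Record PointedCategory := {
  pcat :> Category;
  zero : forall X Y : pcat, hom X Y;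
  zero_comp : forall (X Y Z : pcat) (f : hom X Y), zero Y Z ∘ f = zero X Z;
  comp_zero : forall (X Y Z : pcat) (f : hom Y Z), f ∘ zero X Y = zero X Z
}.
Arguments zero {_} _ _.

Definition IsKernel (C : PointedCategory) (K X Y : C) (k : hom K X)
  (f : hom X Y) : Prop :=
  f ∘ k = zero K Y /\
  forall Z (z : hom Z X), f ∘ z = zero Z Y -> exists! u : hom Z K, k ∘ u = z.

(** The (co)limits are given by an arbitrary choice of an object and morphisms
    for each diagram, with the universal property as a proposition; the mediating morphisms are obtained by unique choice. *)

Definition the (A : Type) (P : A -> Prop) (H : exists! x, P x) : A :=
  proj1_sig (constructive_definite_description P H).

Lemma the_spec (A : Type) (P : A -> Prop) (H : exists! x, P x) : P (the H).
Proof. exact (proj2_sig (constructive_definite_description P H)). Qed.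

Class HasBinaryProducts (C : Category) := {
  prod_obj : C -> C -> C;
  pr1 : forall X Y, hom (prod_obj X Y) X;
  pr2 : forall X Y, hom (prod_obj X Y) Y;
  prod_univ : forall X Y, IsProduct (pr1 X Y) (pr2 X Y)
}.

Class HasBinaryCoproducts (C : Category) := {
  coprod : C -> C -> C;
  inj1 : forall X Y, hom X (coprod X Y);
  inj2 : forall X Y, hom Y (coprod X Y);
  coprod_univ : forall X Y, IsCoproduct (inj1 X Y) (inj2 X Y)
}.
Arguments inj1 {_ _} _ _.
Arguments inj2 {_ _} _ _.

Record Kernel (C : PointedCategory) (X Y : C) (f : hom X Y) := {
  ker_obj : C;
  ker_mor : hom ker_obj X;
  ker_univ : IsKernel ker_mor f
}.

Class HasSplitEpiKernels (C : PointedCategory) :=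
  split_epi_kernel : forall (A B : C) (alpha : hom A B) (beta : hom B A),
    alpha ∘ beta = idm B -> Kernel alpha.

Record Coequalizer (C : Category) (X Y : C) (d c : hom X Y) := {
  coeq_obj : C;
  coeq_mor : hom Y coeq_obj;
  coeq_univ : IsCoequalizer d c coeq_mor
}.

Class HasReflexiveCoequalizers (C : Category) :=
  reflexive_coequalizer :
    forall (C1 C0 : C) (d c : hom C1 C0) (e : hom C0 C1),
      d ∘ e = idm C0 -> c ∘ e = idm C0 -> Coequalizer d c.

Section Copairing.

Context {C : Category} {HC : HasBinaryCoproducts C}.

Definition copair (X Y Z : C) (f : hom X Z) (g : hom Y Z) :
  hom (coprod X Y) Z := the (coprod_univ f g).

Definition comap (X Y X' Y' : C) (f : hom X X') (g : hom Y Y') :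
  hom (coprod X Y) (coprod X' Y') :=
  copair (inj1 X' Y' ∘ f) (inj2 X' Y' ∘ g).

Lemma copair_inj1 (X Y Z : C) (f : hom X Z) (g : hom Y Z) :
  copair f g ∘ inj1 X Y = f.
Proof. exact (proj1 (the_spec (coprod_univ f g))). Qed.

Lemma copair_inj2 (X Y Z : C) (f : hom X Z) (g : hom Y Z) :
  copair f g ∘ inj2 X Y = g.
Proof. exact (proj2 (the_spec (coprod_univ f g))). Qed.

Lemma coprod_ext (X Y Z : C) (h h' : hom (coprod X Y) Z) :
  h ∘ inj1 X Y = h' ∘ inj1 X Y -> h ∘ inj2 X Y = h' ∘ inj2 X Y -> h = h'.
Proof.
  intros E1 E2.
  destruct (coprod_univ (h' ∘ inj1 X Y) (h' ∘ inj2 X Y)) as [u [_ U]].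
  rewrite <- (U h (conj E1 E2)). now apply U.
Qed.

Lemma comp_copair (X Y Z W : C) (h : hom Z W) (f : hom X Z) (g : hom Y Z) :
  h ∘ copair f g = copair (h ∘ f) (h ∘ g).
Proof.
  apply coprod_ext; rewrite <- compA, ?copair_inj1, ?copair_inj2; reflexivity.
Qed.

Lemma copair_comap (X Y X' Y' Z : C) (f' : hom X' Z) (g' : hom Y' Z)
  (f : hom X X') (g : hom Y Y') :
  copair f' g' ∘ comap f g = copair (f' ∘ f) (g' ∘ g).
Proof.
  unfold comap. now rewrite comp_copair, !compA, copair_inj1, copair_inj2.
Qed.

Lemma comap_comp (X Y X' Y' X'' Y'' : C) (f' : hom X' X'') (g' : hom Y' Y'')
  (f : hom X X') (g : hom Y Y') :
  comap f' g' ∘ comap f g = comap (f' ∘ f) (g' ∘ g).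
Proof. unfold comap at 1. now rewrite copair_comap, <- !compA. Qed.

Lemma copair_inj (X Y : C) : copair (inj1 X Y) (inj2 X Y) = idm (coprod X Y).
Proof.
  apply coprod_ext; now rewrite ?copair_inj1, ?copair_inj2, comp_idl.
Qed.

Lemma comap_id (X Y : C) : comap (idm X) (idm Y) = idm (coprod X Y).
Proof. unfold comap. now rewrite !comp_idr, copair_inj. Qed.

End Copairing.

Lemma ker_mono (C : PointedCategory) (K X Y : C) (k : hom K X) (f : hom X Y)
  (Hk : IsKernel k f) (Z : C) (u v : hom Z K) : k ∘ u = k ∘ v -> u = v.
Proof.
  intros E. destruct Hk as [H0 H].
  assert (E0 : f ∘ (k ∘ v) = zero Z Y) by now rewrite compA, H0, zero_comp.
  destruct (H Z (k ∘ v) E0) as [w [_ U]].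
  rewrite <- (U u E). now apply U.
Qed.

Lemma coeq_epi (C : Category) (X Y Q : C) (d c : hom X Y) (q : hom Y Q)
  (Hq : IsCoequalizer d c q) (Z : C) (u v : hom Q Z) : u ∘ q = v ∘ q -> u = v.
Proof.
  intros E. destruct Hq as [H0 H].
  assert (E0 : (v ∘ q) ∘ d = (v ∘ q) ∘ c) by now rewrite <- !compA, H0.
  destruct (H Z (v ∘ q) E0) as [w [_ U]].
  rewrite <- (U u E). now apply U.
Qed.

Record PtObj (C : Category) := {
  pt_dom : C;
  pt_cod : C;
  pt_epi : hom pt_dom pt_cod;
  pt_sec : hom pt_cod pt_dom;
  pt_split : pt_epi ∘ pt_sec = idm pt_cod
}.

Record PtHom (C : Category) (P Q : PtObj C) := {
  pt_f1 : hom (pt_dom P) (pt_dom Q);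
  pt_f0 : hom (pt_cod P) (pt_cod Q);
  pt_hom_epi : pt_epi Q ∘ pt_f1 = pt_f0 ∘ pt_epi P;
  pt_hom_sec : pt_f1 ∘ pt_sec P = pt_sec Q ∘ pt_f0
}.

Lemma PtHom_eq (C : Category) (P Q : PtObj C) (u v : PtHom P Q) :
  pt_f1 u = pt_f1 v -> pt_f0 u = pt_f0 v -> u = v.
Proof.
  destruct u, v; simpl; intros; subst. f_equal; apply proof_irrelevance.
Qed.

Definition Pt (C : Category) : Category.
Proof.
  unshelve refine {| obj := PtObj C; hom := @PtHom C;
    idm := fun P => {| pt_f1 := idm (pt_dom P); pt_f0 := idm (pt_cod P) |};
    comp := fun P Q R v u => {| pt_f1 := pt_f1 v ∘ pt_f1 u;
                                pt_f0 := pt_f0 v ∘ pt_f0 u |} |}.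
  - now rewrite comp_idl, comp_idr.
  - now rewrite comp_idl, comp_idr.
  - now rewrite compA, pt_hom_epi, <- compA, pt_hom_epi, compA.
  - now rewrite <- compA, pt_hom_sec, compA, pt_hom_sec, compA.
  - intros; apply PtHom_eq; apply comp_idl.
  - intros; apply PtHom_eq; apply comp_idr.
  - intros; apply PtHom_eq; apply compA.
Defined.

Section Actions.

Context {B : PointedCategory} {HC : HasBinaryCoproducts B}
  {HK : HasSplitEpiKernels B}.

(** [zero_one Y X] is the morphism [0 1] from the coproduct of [X] and [Y] to
    [Y]; the order of the arguments follows that of [flat]. *)
Definition zero_one (Y X : B) : hom (coprod X Y) Y := copair (zero X Y) (idm Y).

Definition flat_kernel (Y X : B) : Kernel (zero_one Y X) :=
  split_epi_kernel (copair_inj2 (zero X Y) (idm Y)).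

Definition flat (Y X : B) : B := ker_obj (flat_kernel Y X).

Definition flat_k (Y X : B) : hom (flat Y X) (coprod X Y) :=
  ker_mor (flat_kernel Y X).

Definition flat_lift (Y X Z : B) (z : hom Z (coprod X Y))
  (Hz : zero_one Y X ∘ z = zero Z Y) : hom Z (flat Y X) :=
  the (proj2 (ker_univ (flat_kernel Y X)) Z z Hz).

Lemma flat_lift_spec (Y X Z : B) (z : hom Z (coprod X Y))
  (Hz : zero_one Y X ∘ z = zero Z Y) : flat_k Y X ∘ flat_lift Hz = z.
Proof. exact (the_spec (proj2 (ker_univ (flat_kernel Y X)) Z z Hz)). Qed.

Lemma flat_mono (Y X Z : B) (u v : hom Z (flat Y X)) :
  flat_k Y X ∘ u = flat_k Y X ∘ v -> u = v.
Proof. exact (ker_mono (ker_univ (flat_kernel Y X)) (u:=u) (v:=v)). Qed.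

Lemma zero_one_k (Y X : B) : zero_one Y X ∘ flat_k Y X = zero (flat Y X) Y.
Proof. exact (proj1 (ker_univ (flat_kernel Y X))). Qed.

Lemma zero_one_inj1 (Y X : B) : zero_one Y X ∘ inj1 X Y = zero X Y.
Proof. apply copair_inj1. Qed.

Lemma zero_one_inj2 (Y X : B) : zero_one Y X ∘ inj2 X Y = idm Y.
Proof. apply copair_inj2. Qed.

Definition flat_eta (Y X : B) : hom X (flat Y X) :=
  flat_lift (zero_one_inj1 Y X).

Definition k_iota2 (Y X : B) : hom (coprod (flat Y X) Y) (coprod X Y) :=
  copair (flat_k Y X) (inj2 X Y).

Lemma zero_one_k_iota2 (Y X : B) :
  zero_one Y X ∘ k_iota2 Y X = zero_one Y (flat Y X).
Proof. unfold k_iota2. now rewrite comp_copair, zero_one_k, zero_one_inj2. Qed.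

Lemma flat_mu_zero (Y X : B) :
  zero_one Y X ∘ (k_iota2 Y X ∘ flat_k Y (flat Y X))
  = zero (flat Y (flat Y X)) Y.
Proof. now rewrite compA, zero_one_k_iota2, zero_one_k. Qed.

Definition flat_mu (Y X : B) : hom (flat Y (flat Y X)) (flat Y X) :=
  flat_lift (flat_mu_zero Y X).

Lemma zero_one_comap (Y X Y' X' : B) (g : hom Y Y') (f : hom X X') :
  zero_one Y' X' ∘ comap f g = g ∘ zero_one Y X.
Proof.
  unfold zero_one.
  now rewrite copair_comap, comp_copair, zero_comp, comp_zero, comp_idl, comp_idr.
Qed.

Lemma flat_map_zero (Y X Y' X' : B) (g : hom Y Y') (f : hom X X') :
  zero_one Y' X' ∘ (comap f g ∘ flat_k Y X) = zero (flat Y X) Y'.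
Proof. now rewrite compA, zero_one_comap, <- compA, zero_one_k, comp_zero. Qed.

Definition flat_map (Y X Y' X' : B) (g : hom Y Y') (f : hom X X') :
  hom (flat Y X) (flat Y' X') := flat_lift (flat_map_zero g f).

Lemma flat_map_k (Y X Y' X' : B) (g : hom Y Y') (f : hom X X') :
  flat_k Y' X' ∘ flat_map g f = comap f g ∘ flat_k Y X.
Proof. apply flat_lift_spec. Qed.

Lemma flat_map_id (Y X : B) : flat_map (idm Y) (idm X) = idm (flat Y X).
Proof.
  apply flat_mono. now rewrite flat_map_k, comap_id, comp_idl, comp_idr.
Qed.

Lemma flat_map_comp (Y X Y' X' Y'' X'' : B) (g' : hom Y' Y'') (f' : hom X' X'')
  (g : hom Y Y') (f : hom X X') :
  flat_map (g' ∘ g) (f' ∘ f) = flat_map g' f' ∘ flat_map g f.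
Proof.
  apply flat_mono.
  now rewrite compA, !flat_map_k, <- compA, flat_map_k, compA, comap_comp.
Qed.

Record ActObj := {
  act_X : B;
  act_B : B;
  act_xi : hom (flat act_B act_X) act_X;
  act_unit : act_xi ∘ flat_eta act_B act_X = idm act_X;
  act_mult : act_xi ∘ flat_mu act_B act_X
             = act_xi ∘ flat_map (idm act_B) act_xi
}.

Record ActHom (P Q : ActObj) := {
  act_f : hom (act_X P) (act_X Q);
  act_g : hom (act_B P) (act_B Q);
  act_hom_eq : act_xi Q ∘ flat_map act_g act_f = act_f ∘ act_xi P
}.

Lemma ActHom_eq (P Q : ActObj) (u v : ActHom P Q) :
  act_f u = act_f v -> act_g u = act_g v -> u = v.
Proof.
  destruct u, v; simpl; intros; subst. f_equal; apply proof_irrelevance.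
Qed.

Definition Act : Category.
Proof.
  unshelve refine {| obj := ActObj; hom := ActHom;
    idm := fun P => {| act_f := idm (act_X P); act_g := idm (act_B P) |};
    comp := fun P Q R v u => {| act_f := act_f v ∘ act_f u;
                                act_g := act_g v ∘ act_g u |} |}.
  - now rewrite flat_map_id, comp_idl, comp_idr.
  - now rewrite flat_map_comp, compA, act_hom_eq, <- compA, act_hom_eq, compA.
  - intros; apply ActHom_eq; apply comp_idl.
  - intros; apply ActHom_eq; apply comp_idr.
  - intros; apply ActHom_eq; apply compA.
Defined.

Context {HQ : HasReflexiveCoequalizers B}.

Lemma k_iota2_refl (P : Act) :
  k_iota2 (act_B P) (act_X P)
    ∘ comap (flat_eta (act_B P) (act_X P)) (idm (act_B P))
  = idm (coprod (act_X P) (act_B P)).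
Proof.
  unfold k_iota2, flat_eta.
  now rewrite copair_comap, flat_lift_spec, comp_idr, copair_inj.
Qed.

Lemma xi_one_refl (P : Act) :
  comap (act_xi P) (idm (act_B P))
    ∘ comap (flat_eta (act_B P) (act_X P)) (idm (act_B P))
  = idm (coprod (act_X P) (act_B P)).
Proof. now rewrite comap_comp, act_unit, comp_idl, comap_id. Qed.

Definition F_coeq (P : Act) :
  Coequalizer (k_iota2 (act_B P) (act_X P))
              (comap (act_xi P) (idm (act_B P))) :=
  reflexive_coequalizer (k_iota2_refl P) (xi_one_refl P).

Definition F_obj (P : Act) : B := coeq_obj (F_coeq P).

Definition sigma (P : Act) : hom (coprod (act_X P) (act_B P)) (F_obj P) :=
  coeq_mor (F_coeq P).

Definition F_desc (P : Act) (Z : B) (z : hom (coprod (act_X P) (act_B P)) Z)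
  (Hz : z ∘ k_iota2 (act_B P) (act_X P)
        = z ∘ comap (act_xi P) (idm (act_B P))) : hom (F_obj P) Z :=
  the (proj2 (coeq_univ (F_coeq P)) Z z Hz).

Lemma F_desc_spec (P : Act) (Z : B) (z : hom (coprod (act_X P) (act_B P)) Z)
  (Hz : z ∘ k_iota2 (act_B P) (act_X P)
        = z ∘ comap (act_xi P) (idm (act_B P))) : F_desc Hz ∘ sigma P = z.
Proof. exact (the_spec (proj2 (coeq_univ (F_coeq P)) Z z Hz)). Qed.

Lemma sigma_epi (P : Act) (Z : B) (u v : hom (F_obj P) Z) :
  u ∘ sigma P = v ∘ sigma P -> u = v.
Proof. exact (coeq_epi (coeq_univ (F_coeq P)) (u:=u) (v:=v)). Qed.

Lemma sigma_coeq (P : Act) :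
  sigma P ∘ k_iota2 (act_B P) (act_X P)
  = sigma P ∘ comap (act_xi P) (idm (act_B P)).
Proof. exact (proj1 (coeq_univ (F_coeq P))). Qed.

Lemma zero_one_coeq (P : Act) :
  zero_one (act_B P) (act_X P) ∘ k_iota2 (act_B P) (act_X P)
  = zero_one (act_B P) (act_X P) ∘ comap (act_xi P) (idm (act_B P)).
Proof. now rewrite zero_one_k_iota2, zero_one_comap, comp_idl. Qed.

Definition zero_one_bar (P : Act) : hom (F_obj P) (act_B P) :=
  F_desc (zero_one_coeq P).

Lemma zero_one_bar_sigma (P : Act) :
  zero_one_bar P ∘ sigma P = zero_one (act_B P) (act_X P).
Proof. apply F_desc_spec. Qed.

Lemma zero_one_bar_split (P : Act) :
  zero_one_bar P ∘ (sigma P ∘ inj2 (act_X P) (act_B P)) = idm (act_B P).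
Proof. now rewrite compA, zero_one_bar_sigma, zero_one_inj2. Qed.

Definition T_obj (P : Act) : Pt B :=
  {| pt_dom := F_obj P; pt_cod := act_B P; pt_epi := zero_one_bar P;
     pt_sec := sigma P ∘ inj2 (act_X P) (act_B P);
     pt_split := zero_one_bar_split P |}.

Lemma F_map_coeq (P Q : Act) (u : hom P Q) :
  (sigma Q ∘ comap (act_f u) (act_g u)) ∘ k_iota2 (act_B P) (act_X P)
  = (sigma Q ∘ comap (act_f u) (act_g u))
      ∘ comap (act_xi P) (idm (act_B P)).
Proof.
  rewrite <- !compA.
  assert (E : comap (act_f u) (act_g u) ∘ k_iota2 (act_B P) (act_X P)
     = k_iota2 (act_B Q) (act_X Q)
         ∘ comap (flat_map (act_g u) (act_f u)) (act_g u)).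
  { unfold k_iota2. rewrite copair_comap, comp_copair, flat_map_k.
    unfold comap at 2. now rewrite copair_inj2. }
  rewrite E, compA, sigma_coeq, <- compA, !comap_comp.
  now rewrite comp_idl, comp_idr, act_hom_eq.
Qed.

Definition F_map (P Q : Act) (u : hom P Q) : hom (F_obj P) (F_obj Q) :=
  F_desc (F_map_coeq u).

Lemma F_map_sigma (P Q : Act) (u : hom P Q) :
  F_map u ∘ sigma P = sigma Q ∘ comap (act_f u) (act_g u).
Proof. apply F_desc_spec. Qed.

Lemma F_map_epi (P Q : Act) (u : hom P Q) :
  zero_one_bar Q ∘ F_map u = act_g u ∘ zero_one_bar P.
Proof.
  apply sigma_epi.
  now rewrite <- !compA, F_map_sigma, compA, !zero_one_bar_sigma, zero_one_comap.
Qed.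

Lemma F_map_sec (P Q : Act) (u : hom P Q) :
  F_map u ∘ (sigma P ∘ inj2 (act_X P) (act_B P))
  = (sigma Q ∘ inj2 (act_X Q) (act_B Q)) ∘ act_g u.
Proof.
  rewrite compA, F_map_sigma, <- !compA. unfold comap. now rewrite copair_inj2.
Qed.

Definition T_map (P Q : Act) (u : hom P Q) : hom (T_obj P) (T_obj Q) :=
  {| pt_f1 := F_map u : hom (pt_dom (T_obj P)) (pt_dom (T_obj Q));
     pt_f0 := act_g u;
     pt_hom_epi := F_map_epi u; pt_hom_sec := F_map_sec u |}.

Definition T : Functor Act (Pt B).
Proof.
  refine {| fobj := T_obj; fmap := T_map |}.
  - intros P. apply PtHom_eq; [|reflexivity]. apply sigma_epi. simpl.
    rewrite F_map_sigma. simpl. now rewrite comap_id, comp_idl, comp_idr.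
  - intros P Q R v u. apply PtHom_eq; [|reflexivity]. apply sigma_epi.
    change (F_map (v ∘ u) ∘ sigma P = (F_map v ∘ F_map u) ∘ sigma P).
    rewrite <- (compA (F_map v)), !F_map_sigma, compA, F_map_sigma, <- compA.
    now rewrite comap_comp.
Defined.

End Actions.

Arguments Act B {HC HK}.
Arguments T B {HC HK HQ}.

Definition SplitShortFiveLemma (B : PointedCategory) : Prop :=
  forall (P P' : Pt B) (X X' : B)
    (k : hom X (pt_dom P)) (k' : hom X' (pt_dom P'))
    (f : hom X X') (h : hom (pt_dom P) (pt_dom P'))
    (g : hom (pt_cod P) (pt_cod P')),
    IsKernel k (pt_epi P) -> IsKernel k' (pt_epi P') ->
    h ∘ k = k' ∘ f ->
    pt_epi P' ∘ h = g ∘ pt_epi P ->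
    h ∘ pt_sec P = pt_sec P' ∘ g ->
    IsIso g -> IsIso f -> IsIso h.

(* Main.v *)
(** The functor [T] is left adjoint to the functor [K] that sends a split
    epimorphism [(A, α, β, B)] with chosen kernel [κ : X -> A] to the action [ξ]
    of [B] on [X] determined by [κ ξ = [κ β] k].  The unit at [(X, ξ, B)] is the
    factorization of [σ ι1] through the kernel of the split epimorphism, so it
    is invertible exactly when (A1) holds at [(X, ξ, B)].  If (A1) holds, the
    counit induces isomorphisms on kernels and on codomains, and (A2) makes it
    invertible.  Conversely, if [T] is an equivalence, then it is full and
    faithful, which makes the unit invertible; a morphism as in (A2) may then be
    replaced by one of the form [T u], for which [u] consists of isomorphisms. *)

Require Import Defs.

Set Implicit Arguments.
Unset Strict Implicit.
Unset Printing Implicit Defensive.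

(** * Isomorphisms: composition, cancellation and inverses *)

Section Isomorphisms.

Context {C : Category}.

Lemma iso_id (X : C) : IsIso (idm X).
Proof. exists (idm X). split; apply comp_idl. Qed.

Lemma iso_comp (X Y Z : C) (g : hom Y Z) (f : hom X Y) :
  IsIso g -> IsIso f -> IsIso (g ∘ f).
Proof.
  intros [g' [G1 G2]] [f' [F1 F2]]. exists (f' ∘ g'). split.
  - now rewrite compA, <- (compA f'), G1, comp_idr.
  - now rewrite compA, <- (compA g), F2, comp_idr.
Qed.

Lemma iso_cancel (X Y Z W : C) (v : hom Y Z) (u : hom W X) (h : hom X Y) :
  IsIso v -> IsIso u -> IsIso (v ∘ h ∘ u) -> IsIso h.
Proof.
  intros [v' [V1 V2]] [u' [U1 U2]] H.
  assert (E : h = v' ∘ (v ∘ h ∘ u) ∘ u').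
  { now rewrite !compA, V1, comp_idl, <- compA, U2, comp_idr. }
  rewrite E. apply iso_comp; [apply iso_comp|].
  - now exists v.
  - exact H.
  - now exists u.
Qed.

Lemma iso_mono (X Y Z : C) (h : hom Y Z) (u v : hom X Y) :
  IsIso h -> h ∘ u = h ∘ v -> u = v.
Proof.
  intros [h' [H1 _]] E.
  now rewrite <- (comp_idl u), <- (comp_idl v), <- H1, <- !compA, E.
Qed.

Lemma iso_epi (X Y Z : C) (h : hom X Y) (u v : hom Y Z) :
  IsIso h -> u ∘ h = v ∘ h -> u = v.
Proof.
  intros [h' [_ H2]] E.
  now rewrite <- (comp_idr u), <- (comp_idr v), <- H2, !compA, E.
Qed.

(** Invertibility is only a proposition; uniqueness of the inverse allows [the] to select one for
    every component of a natural isomorphism at once. *)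
Lemma inverse_exists_unique (X Y : C) (f : hom X Y) :
  IsIso f -> exists! g : hom Y X, g ∘ f = idm X /\ f ∘ g = idm Y.
Proof.
  intros Hf. destruct (Hf) as [g [G1 G2]]. exists g. split; [easy|].
  intros g' [_ G2']. apply (iso_mono Hf). now rewrite G2, G2'.
Qed.

End Isomorphisms.

(** * Functors, natural isomorphisms and consequences of equivalence *)

Section Functors.

Context {C D : Category}.

Lemma fmap_iso (F : Functor C D) (X Y : C) (f : hom X Y) :
  IsIso f -> IsIso (fmap F f).
Proof.
  intros [g [G1 G2]]. exists (fmap F g).
  now rewrite <- !fmap_comp, G1, G2, !fmap_id.
Qed.

Lemma NaturallyIsomorphic_sym (F G : Functor C D) :
  NaturallyIsomorphic F G -> NaturallyIsomorphic G F.
Proof.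
  intros [t [N I]].
  pose (s X := the (inverse_exists_unique (I X))).
  assert (S : forall X, s X ∘ t X = idm (F X) /\ t X ∘ s X = idm (G X))
    by (intros X; apply the_spec).
  exists s. split.
  - intros X Y f. apply (iso_mono (I Y)).
    now rewrite !compA, (proj2 (S Y)), N, <- compA, (proj2 (S X)),
      comp_idl, comp_idr.
  - intros X. exists (t X). now destruct (S X).
Qed.

(** Naturality writes [u ∘ t X] in terms of [fmap F u], and [t X] is epic. The hypothesis concerns a
    single composite, so the lemma applies to either functor of an equivalence. *)
Lemma faithful_of_retraction (F : Functor C D) (G : Functor D C) :
  NaturallyIsomorphic (compF G F) (idF C) ->
  forall (X Y : C) (u v : hom X Y), fmap F u = fmap F v -> u = v.
Proof.
  intros [t [N I]] X Y u v E.
  apply (iso_epi (I X)).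
  transitivity (t Y ∘ fmap (compF G F) u); [symmetry; exact (N X Y u)|].
  simpl. rewrite E. exact (N X Y v).
Qed.

End Functors.

Section Equivalences.

Context {C D : Category} {F : Functor C D}.
Hypothesis HF : IsEquivalence F.

Lemma equivalence_faithful (X Y : C) (u v : hom X Y) :
  fmap F u = fmap F v -> u = v.
Proof. destruct HF as [G [N _]]. now apply (faithful_of_retraction N). Qed.

Lemma equivalence_full (X Y : C) (v : hom (F X) (F Y)) :
  exists u : hom X Y, fmap F u = v.
Proof.
  destruct HF as [G [[t [N I]] M]].
  destruct (I X) as [s [S1 S2]]. simpl in *.
  (* The preimage is [fmap G v] conjugated by the natural isomorphism, [s] being the inverse of
     [t X]. As [G] is faithful, it is enough to compare the images under [G], composed with the
     monic [t Y]. *)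
  exists (t Y ∘ fmap G v ∘ s).
  apply (faithful_of_retraction M), (iso_mono (I Y)).
  transitivity ((t Y ∘ fmap G v ∘ s) ∘ t X);
    [exact (N X Y (t Y ∘ fmap G v ∘ s))|].
  now rewrite <- compA, S1, comp_idr.
Qed.

Lemma equivalence_essentially_surjective (Y : D) :
  exists (X : C) (v : hom (F X) Y), IsIso v.
Proof.
  destruct HF as [G [_ [t [_ I]]]]. exists (G Y), (t Y). apply I.
Qed.

End Equivalences.

(** * Kernels and their invariance under isomorphism *)

Section Kernels.

Context {C : PointedCategory}.

Lemma kernel_lift (K X Y Z : C) (k : hom K X) (f : hom X Y) (z : hom Z X) :
  IsKernel k f -> f ∘ z = zero Z Y -> exists u : hom Z K, k ∘ u = z.
Proof. intros [_ H] E. destruct (H Z z E) as [u [U _]]. now exists u. Qed.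

Lemma kernel_precomp_iso (K K' X Y : C) (k : hom K X) (f : hom X Y)
  (i : hom K' K) : IsKernel k f -> IsIso i -> IsKernel (k ∘ i) f.
Proof.
  intros Hk [j [J1 J2]]. split.
  - now rewrite compA, (proj1 Hk), zero_comp.
  - intros Z z E. destruct (kernel_lift Hk E) as [u U].
    exists (j ∘ u). split.
    + now rewrite compA, <- (compA k), J2, comp_idr.
    + intros v V.
      assert (Ev : i ∘ v = u) by (apply (ker_mono Hk); now rewrite compA, V, U).
      now rewrite <- Ev, compA, J1, comp_idl.
Qed.

Lemma kernel_postcomp_iso (K X Y X' Y' : C) (k : hom K X) (f : hom X Y)
  (f' : hom X' Y') (a : hom X X') (b : hom Y Y') :
  IsIso a -> IsIso b -> f' ∘ a = b ∘ f -> IsKernel k f -> IsKernel (a ∘ k) f'.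
Proof.
  intros Ha Hb E Hk. split.
  - now rewrite compA, E, <- compA, (proj1 Hk), comp_zero.
  - intros Z z Ez.
    destruct Ha as [a' [A1 A2]].
    assert (Ez' : f ∘ (a' ∘ z) = zero Z Y).
    { apply (iso_mono Hb).
      now rewrite !compA, <- E, <- (compA f'), A2, comp_idr, comp_zero. }
    destruct (kernel_lift Hk Ez') as [u U].
    exists u. split.
    + now rewrite <- compA, U, compA, A2, comp_idl.
    + intros v V. apply (ker_mono Hk).
      now rewrite U, <- V, !compA, A1, comp_idl.
Qed.

Lemma kernel_comparison_iso (K L X Y : C) (k : hom K X) (l : hom L X)
  (f : hom X Y) :
  IsKernel k f -> IsKernel l f -> exists i : hom K L, IsIso i /\ l ∘ i = k.
Proof.
  intros Hk Hl.
  destruct (kernel_lift Hl (proj1 Hk)) as [i I].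
  destruct (kernel_lift Hk (proj1 Hl)) as [j J].
  exists i. split; [|exact I]. exists j. split.
  - apply (ker_mono Hk). now rewrite compA, J, I, comp_idr.
  - apply (ker_mono Hl). now rewrite compA, I, J, comp_idr.
Qed.

(** Two kernels of one morphism differ by a comparison isomorphism, so [a] is [f] composed with two
    such. This relates the arbitrary kernels of (A2) to those of the form σι1. *)
Lemma induced_kernel_map_iso (K L K' L' X Y X' Y' : C)
  (p : hom X Y) (p' : hom X' Y') (h : hom X X')
  (k : hom K X) (l : hom L X) (k' : hom K' X') (l' : hom L' X')
  (f : hom K K') (a : hom L L') :
  IsKernel k p -> IsKernel l p -> IsKernel k' p' -> IsKernel l' p' ->
  h ∘ k = k' ∘ f -> h ∘ l = l' ∘ a -> IsIso f -> IsIso a.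
Proof.
  intros Hk Hl Hk' Hl' Ef Ea If.
  destruct (kernel_comparison_iso Hl Hk) as [i [Ii Ei]].
  destruct (kernel_comparison_iso Hk' Hl') as [j [Ij Ej]].
  assert (E : a = j ∘ f ∘ i).
  { apply (ker_mono Hl').
    now rewrite !compA, Ej, <- Ef, <- compA, Ei. }
  rewrite E. now repeat apply iso_comp.
Qed.

End Kernels.

(** * Componentwise isomorphisms of split epimorphisms and of actions *)

Lemma Pt_iso (C : Category) (P Q : Pt C) (u : hom P Q) :
  IsIso u <-> IsIso (pt_f1 u) /\ IsIso (pt_f0 u).
Proof.
  split.
  - intros [v [V1 V2]]. split.
    + exists (pt_f1 v). split; [exact (f_equal (@pt_f1 _ _ _) V1)
                               |exact (f_equal (@pt_f1 _ _ _) V2)].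
    + exists (pt_f0 v). split; [exact (f_equal (@pt_f0 _ _ _) V1)
                               |exact (f_equal (@pt_f0 _ _ _) V2)].
  - intros [I1 I0].
    destruct (I1) as [v1 [V1 V1']], (I0) as [v0 [V0 V0']].
    assert (Ee : pt_epi P ∘ v1 = v0 ∘ pt_epi Q).
    { apply (iso_mono I0).
      now rewrite !compA, <- pt_hom_epi, <- compA, V1', V0', comp_idl, comp_idr. }
    assert (Es : v1 ∘ pt_sec Q = pt_sec P ∘ v0).
    { apply (iso_mono I1).
      now rewrite !compA, pt_hom_sec, <- (compA (pt_sec Q)), V1', V0', comp_idl, comp_idr. }
    exists {| pt_f1 := v1; pt_f0 := v0; pt_hom_epi := Ee; pt_hom_sec := Es |}.
    split; now apply PtHom_eq.
Qed.

Section Adjunction.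

Context {B : PointedCategory} {HC : HasBinaryCoproducts B}
  {HK : HasSplitEpiKernels B}.

(** Functoriality of [flat_map] makes the pair of inverse components equivariant. *)
Lemma Act_iso (P Q : Act B) (u : hom P Q) :
  IsIso (act_f u) -> IsIso (act_g u) -> IsIso u.
Proof.
  intros [f' [F1 F2]] [g' [G1 G2]].
  assert (E : act_xi P ∘ flat_map g' f' = f' ∘ act_xi Q).
  { rewrite <- (comp_idl (act_xi P)), <- F1, <- (compA f'), <- act_hom_eq.
    now rewrite <- !compA, <- flat_map_comp, F2, G2, flat_map_id, comp_idr. }
  exists {| act_f := f'; act_g := g'; act_hom_eq := E |}.
  split; now apply ActHom_eq.
Qed.

Lemma Act_iso_f (P Q : Act B) (u : hom P Q) : IsIso u -> IsIso (act_f u).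
Proof.
  intros [v [V1 V2]]. exists (act_f v). split;
    [exact (f_equal (@act_f _ _ _ _ _) V1)|exact (f_equal (@act_f _ _ _ _ _) V2)].
Qed.

Lemma flat_k_eta (Y X : B) : flat_k Y X ∘ flat_eta Y X = inj1 X Y.
Proof. apply flat_lift_spec. Qed.

Lemma flat_k_mu (Y X : B) :
  flat_k Y X ∘ flat_mu Y X = k_iota2 Y X ∘ flat_k Y (flat Y X).
Proof. apply flat_lift_spec. Qed.

(** * The functor from split epimorphisms to actions *)

Definition pt_kernel (P : Pt B) : Kernel (pt_epi P) :=
  split_epi_kernel (pt_split P).

Definition kappa (P : Pt B) : hom (ker_obj (pt_kernel P)) (pt_dom P) :=
  ker_mor (pt_kernel P).

Lemma kappa_kernel (P : Pt B) : IsKernel (kappa P) (pt_epi P).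
Proof. exact (ker_univ (pt_kernel P)). Qed.

Definition kappa_lift (P : Pt B) (Z : B) (z : hom Z (pt_dom P))
  (Hz : pt_epi P ∘ z = zero Z (pt_cod P)) : hom Z (ker_obj (pt_kernel P)) :=
  the (proj2 (kappa_kernel P) Z z Hz).

Lemma kappa_lift_spec (P : Pt B) (Z : B) (z : hom Z (pt_dom P))
  (Hz : pt_epi P ∘ z = zero Z (pt_cod P)) : kappa P ∘ kappa_lift Hz = z.
Proof. exact (the_spec (proj2 (kappa_kernel P) Z z Hz)). Qed.

Lemma pt_epi_copair (P : Pt B) :
  pt_epi P ∘ copair (kappa P) (pt_sec P) = zero_one _ _.
Proof.
  unfold zero_one. now rewrite comp_copair, (proj1 (kappa_kernel P)), pt_split.
Qed.

Lemma K_xi_zero (P : Pt B) :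
  pt_epi P ∘ (copair (kappa P) (pt_sec P) ∘ flat_k _ _) = zero _ _.
Proof. now rewrite compA, pt_epi_copair, zero_one_k. Qed.

Definition K_xi (P : Pt B) :
  hom (flat (pt_cod P) (ker_obj (pt_kernel P))) (ker_obj (pt_kernel P)) :=
  kappa_lift (K_xi_zero P).

Lemma kappa_xi (P : Pt B) :
  kappa P ∘ K_xi P = copair (kappa P) (pt_sec P) ∘ flat_k _ _.
Proof. apply kappa_lift_spec. Qed.

Lemma K_unit (P : Pt B) : K_xi P ∘ flat_eta _ _ = idm _.
Proof.
  apply (ker_mono (kappa_kernel P)).
  now rewrite compA, kappa_xi, <- compA, flat_k_eta, copair_inj1, comp_idr.
Qed.

(** Composed with the monic κ, both sides become [κξ β]k', where k' is the kernel defining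
    B♭(B♭X). *)
Lemma K_mult (P : Pt B) :
  K_xi P ∘ flat_mu _ _ = K_xi P ∘ flat_map (idm _) (K_xi P).
Proof.
  apply (ker_mono (kappa_kernel P)).
  rewrite !compA, kappa_xi, <- !compA, flat_k_mu, flat_map_k, !compA.
  unfold k_iota2.
  now rewrite comp_copair, copair_comap, <- kappa_xi, copair_inj2, comp_idr.
Qed.

Definition K_obj (P : Pt B) : Act B :=
  {| act_X := ker_obj (pt_kernel P); act_B := pt_cod P; act_xi := K_xi P;
     act_unit := K_unit P; act_mult := K_mult P |}.

Lemma K_map_zero (P Q : Pt B) (u : hom P Q) :
  pt_epi Q ∘ (pt_f1 u ∘ kappa P) = zero _ _.
Proof.
  now rewrite compA, pt_hom_epi, <- compA, (proj1 (kappa_kernel P)), comp_zero.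
Qed.

Definition K_f (P Q : Pt B) (u : hom P Q) :
  hom (ker_obj (pt_kernel P)) (ker_obj (pt_kernel Q)) := kappa_lift (K_map_zero u).

Lemma kappa_K_f (P Q : Pt B) (u : hom P Q) :
  kappa Q ∘ K_f u = pt_f1 u ∘ kappa P.
Proof. apply kappa_lift_spec. Qed.

Lemma K_map_eq (P Q : Pt B) (u : hom P Q) :
  act_xi (K_obj Q) ∘ flat_map (pt_f0 u) (K_f u) = K_f u ∘ act_xi (K_obj P).
Proof.
  apply (ker_mono (kappa_kernel Q)). simpl.
  rewrite !compA, kappa_xi, kappa_K_f, <- !compA, flat_map_k, kappa_xi, !compA.
  now rewrite copair_comap, comp_copair, kappa_K_f, pt_hom_sec.
Qed.

Definition K_map (P Q : Pt B) (u : hom P Q) : hom (K_obj P) (K_obj Q) :=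
  {| act_f := K_f u : hom (act_X (K_obj P)) (act_X (K_obj Q));
     act_g := pt_f0 u : hom (act_B (K_obj P)) (act_B (K_obj Q));
     act_hom_eq := K_map_eq u |}.

Definition K : Functor (Pt B) (Act B).
Proof.
  refine {| fobj := K_obj; fmap := K_map |}.
  - intros P. apply ActHom_eq; [|reflexivity].
    apply (ker_mono (kappa_kernel P)). simpl.
    rewrite kappa_K_f. exact (eq_trans (comp_idl _) (eq_sym (comp_idr _))).
  - intros P Q R v u. apply ActHom_eq; [|reflexivity].
    apply (ker_mono (kappa_kernel R)). simpl.
    rewrite (compA (kappa R)), !kappa_K_f, <- (compA _ (kappa Q)), kappa_K_f.
    symmetry. apply compA.
Defined.

(** * Transposition and the unit of the adjunction *)

(** The hypothesis is the condition for [κ β](f ⊔ g) to factor through σ. Restricted to the summand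
    B♭X, it is the required equation composed with the monic κ. *)
Lemma transpose_equivariant (P : Act B) (Q : Pt B)
  (f : hom (act_X P) (ker_obj (pt_kernel Q))) (g : hom (act_B P) (pt_cod Q)) :
  copair (kappa Q) (pt_sec Q) ∘ comap f g ∘ k_iota2 _ _
  = copair (kappa Q) (pt_sec Q) ∘ comap f g ∘ comap (act_xi P) (idm _) ->
  K_xi Q ∘ flat_map g f = f ∘ act_xi P.
Proof.
  intros E. apply (ker_mono (kappa_kernel Q)).
  rewrite compA, kappa_xi, <- compA, flat_map_k.
  (* Writing k as [k ι2]ι1 makes the hypothesis applicable. *)
  rewrite <- (copair_inj1 (flat_k _ _) (inj2 (act_X P) (act_B P))).
  fold (k_iota2 (act_B P) (act_X P)).
  rewrite !compA, E, !copair_comap, <- compA.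
  now rewrite copair_inj1.
Qed.

Context {HQ : HasReflexiveCoequalizers B}.

Lemma F_map_sigma_inj1 (P Q : Act B) (u : hom P Q) :
  F_map u ∘ (sigma P ∘ inj1 _ _) = sigma Q ∘ inj1 _ _ ∘ act_f u.
Proof.
  rewrite compA, F_map_sigma, <- !compA. unfold comap. now rewrite copair_inj1.
Qed.

Lemma sigma_inj1_zero (P : Act B) :
  pt_epi (T B P) ∘ (sigma P ∘ inj1 _ _) = zero _ _.
Proof. simpl. now rewrite compA, zero_one_bar_sigma, zero_one_inj1. Qed.

Definition unit_f (P : Act B) :
  hom (act_X P) (ker_obj (pt_kernel (T B P))) :=
  kappa_lift (sigma_inj1_zero P).

Lemma kappa_unit_f (P : Act B) :
  kappa (T B P) ∘ unit_f P = sigma P ∘ inj1 _ _.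
Proof. apply kappa_lift_spec. Qed.

(** The components are σι1, by the choice of [unit_f], and σι2, the section of [T B P]. Thus the
    unit is the transpose of the identity; its equivariance and the triangle identity both rest on
    this. *)
Lemma kappa_copair_unit_f (P : Act B) :
  copair (kappa (T B P)) (pt_sec (T B P)) ∘ comap (unit_f P) (idm (act_B P))
  = sigma P.
Proof.
  rewrite copair_comap, kappa_unit_f, comp_idr. simpl.
  now rewrite <- comp_copair, copair_inj, comp_idr.
Qed.

Lemma unit_eq (P : Act B) :
  act_xi (K (T B P)) ∘ flat_map (idm (act_B P)) (unit_f P)
  = unit_f P ∘ act_xi P.
Proof.
  apply (@transpose_equivariant P (T B P) (unit_f P) (idm (act_B P))).
  pose proof (kappa_copair_unit_f P) as E. simpl in E |- *. rewrite E.
  apply sigma_coeq.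
Qed.

Definition unit_map (P : Act B) : hom P (K (T B P)) :=
  {| act_f := unit_f P : hom _ (act_X (K (T B P)));
     act_g := idm (act_B P) : hom _ (act_B (K (T B P)));
     act_hom_eq := unit_eq P |}.

Lemma unit_natural (P Q : Act B) (u : hom P Q) :
  unit_map Q ∘ u = fmap K (fmap (T B) u) ∘ unit_map P.
Proof.
  apply ActHom_eq; simpl.
  - change (unit_f Q ∘ act_f u = K_f (fmap (T B) u) ∘ unit_f P).
    apply (ker_mono (kappa_kernel (T B Q))).
    rewrite !compA, kappa_K_f, kappa_unit_f, <- (compA _ (kappa (T B P))),
      kappa_unit_f.
    symmetry. apply F_map_sigma_inj1.
  - now rewrite comp_idl, comp_idr.
Qed.

(** * The counit and a triangle identity *)

(** On B♭X this is the equation κξ = [κ β]k that defines the action; on B both sides are β. *)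
Lemma counit_coeq (P : Pt B) :
  copair (kappa P) (pt_sec P) ∘ k_iota2 (act_B (K P)) (act_X (K P))
  = copair (kappa P) (pt_sec P)
      ∘ comap (act_xi (K P)) (idm (act_B (K P))).
Proof.
  unfold k_iota2. simpl.
  now rewrite comp_copair, copair_comap, kappa_xi, copair_inj2, comp_idr.
Qed.

Definition counit_f1 (P : Pt B) : hom (F_obj (K P)) (pt_dom P) :=
  F_desc (P := K P) (counit_coeq P).

Lemma counit_sigma (P : Pt B) :
  counit_f1 P ∘ sigma (K P) = copair (kappa P) (pt_sec P).
Proof. exact (F_desc_spec (counit_coeq P)). Qed.

Lemma counit_epi (P : Pt B) :
  pt_epi P ∘ counit_f1 P = idm (pt_cod P) ∘ pt_epi (T B (K P)).
Proof.
  apply (sigma_epi (P := K P)).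
  rewrite <- (compA _ (counit_f1 P)), counit_sigma, comp_idl.
  exact (eq_trans (pt_epi_copair P) (eq_sym (zero_one_bar_sigma (K P)))).
Qed.

Lemma counit_sec (P : Pt B) :
  counit_f1 P ∘ pt_sec (T B (K P)) = pt_sec P ∘ idm (pt_cod P).
Proof.
  rewrite comp_idr.
  change (counit_f1 P ∘ (sigma (K P) ∘ inj2 _ _) = pt_sec P).
  rewrite compA, counit_sigma. apply copair_inj2.
Qed.

Definition counit (P : Pt B) : hom (T B (K P)) P :=
  {| pt_f1 := counit_f1 P : hom (pt_dom (T B (K P))) (pt_dom P);
     pt_f0 := idm (pt_cod P) : hom (pt_cod (T B (K P))) (pt_cod P);
     pt_hom_epi := counit_epi P; pt_hom_sec := counit_sec P |}.

Lemma counit_natural (P Q : Pt B) (u : hom P Q) :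
  counit Q ∘ fmap (T B) (fmap K u) = u ∘ counit P.
Proof.
  apply PtHom_eq; simpl.
  - change (counit_f1 Q ∘ F_map (fmap K u) = pt_f1 u ∘ counit_f1 P).
    apply (sigma_epi (P := K P)).
    rewrite <- !compA, F_map_sigma, counit_sigma, compA, counit_sigma.
    now rewrite copair_comap, comp_copair, <- kappa_K_f, pt_hom_sec.
  - now rewrite comp_idl, comp_idr.
Qed.

Lemma counit_sigma_inj1 (P : Pt B) :
  counit_f1 P ∘ (sigma (K P) ∘ inj1 _ _) = kappa P.
Proof. rewrite compA, counit_sigma. apply copair_inj1. Qed.

Lemma counit_unit (P : Act B) :
  counit (T B P) ∘ fmap (T B) (unit_map P) = idm (T B P).
Proof.
  apply PtHom_eq; simpl.
  - change (counit_f1 (T B P) ∘ F_map (unit_map P) = idm (F_obj P)).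
    apply sigma_epi.
    rewrite <- compA, F_map_sigma, compA, counit_sigma, comp_idl.
    apply kappa_copair_unit_f.
  - apply comp_idl.
Qed.

(** Since κ is monic, this shows that the transpose of [u] determines the component [act_f u]. *)
Lemma counit_T_inj1 (P : Pt B) (Q : Act B) (u : hom Q (K P)) :
  pt_f1 (counit P ∘ fmap (T B) u) ∘ (sigma Q ∘ inj1 _ _) = kappa P ∘ act_f u.
Proof.
  change (counit_f1 P ∘ F_map u ∘ (sigma Q ∘ inj1 _ _) = kappa P ∘ act_f u).
  now rewrite <- compA, F_map_sigma_inj1, compA, counit_sigma_inj1.
Qed.

(** * From an equivalence to (A1) and (A2) *)

Lemma unit_iso_of_equivalence (P : Act B) :
  IsEquivalence (T B) -> IsIso (unit_map P).
Proof.
  intros HT.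
  (* The counit at [T B P] is a left inverse of the image of the unit, so its lift [r] is the
     candidate inverse of the unit. *)
  destruct (equivalence_full HT (counit (T B P))) as [r R].
  exists r. split.
  - apply (equivalence_faithful HT). now rewrite fmap_comp, R, fmap_id, counit_unit.
  (* The transposes of [unit_map P ∘ r] and of the identity are both the counit. Their components
     therefore agree: on the kernels because κ is monic, on the codomains by reading off [pt_f0]. *)
  - assert (E : counit (T B P) ∘ fmap (T B) (unit_map P ∘ r)
                = counit (T B P) ∘ fmap (T B) (idm _)).
    { now rewrite fmap_comp, compA, counit_unit, comp_idl, R, fmap_id, comp_idr. }
    apply ActHom_eq.
    + apply (ker_mono (kappa_kernel (T B P))).
      rewrite <- !counit_T_inj1. now rewrite E.
    + generalize (f_equal (@pt_f0 _ _ _) E). simpl. now rewrite !comp_idl.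
Qed.

Definition ActionsAreKernels : Prop :=
  forall P : Act B,
    IsKernel (sigma P ∘ inj1 (act_X P) (act_B P)) (zero_one_bar P).

(** By construction σι1 is κ composed with the unit, which is now invertible. *)
Lemma actions_are_kernels_of_equivalence :
  IsEquivalence (T B) -> ActionsAreKernels.
Proof.
  intros HT P. rewrite <- kappa_unit_f.
  apply kernel_precomp_iso; [exact (kappa_kernel (T B P))|].
  exact (Act_iso_f (unit_iso_of_equivalence P HT)).
Qed.

Lemma split_short_five_of_equivalence :
  IsEquivalence (T B) -> SplitShortFiveLemma B.
Proof.
  intros HT P P' X X' k k' f h g Hk Hk' Ef Ee Es Ig If.
  pose (H := {| pt_f1 := h; pt_f0 := g; pt_hom_epi := Ee; pt_hom_sec := Es |}
             : @hom (Pt B) P P').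
  destruct (equivalence_essentially_surjective HT P) as [Q [v Iv]].
  destruct (equivalence_essentially_surjective HT P') as [Q' [v' Iv']].
  destruct (Iv') as [w' [W1 W2]].
  (* Conjugating [H] by the isomorphisms [v] and [v'] gives a morphism between values of [T B],
     which lifts to a morphism [u] of actions. *)
  destruct (equivalence_full HT (w' ∘ H ∘ v)) as [u U].
  assert (E : v' ∘ fmap (T B) u = H ∘ v)
    by now rewrite U, !compA, W2, comp_idl.
  destruct (proj1 (Pt_iso v) Iv) as [Iv1 Iv0].
  destruct (proj1 (Pt_iso v') Iv') as [Iv1' Iv0'].
  assert (E1 : pt_f1 v' ∘ F_map u = h ∘ pt_f1 v)
    by exact (f_equal (@pt_f1 _ _ _) E).
  assert (E0 : pt_f0 v' ∘ act_g u = g ∘ pt_f0 v)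
    by exact (f_equal (@pt_f0 _ _ _) E).
  assert (Iu : IsIso u).
  { apply Act_iso.
    (* Transported along [v] and [v'], the kernels σι1 given by (A1) become kernels of the original
       split epimorphisms. There [h] induces [act_f u], while on [k] and [k'] it induces the
       isomorphism [f]. *)
    - pose proof (actions_are_kernels_of_equivalence HT) as A1.
      apply (@induced_kernel_map_iso B X (act_X Q) X' (act_X Q')
        _ _ _ _ (pt_epi P) (pt_epi P') h
        k (pt_f1 v ∘ (sigma Q ∘ inj1 _ _))
        k' (pt_f1 v' ∘ (sigma Q' ∘ inj1 _ _)) f (act_f u)); trivial.
      + exact (kernel_postcomp_iso Iv1 Iv0 (pt_hom_epi v) (A1 Q)).
      + exact (kernel_postcomp_iso Iv1' Iv0' (pt_hom_epi v') (A1 Q')).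
      + rewrite compA, <- E1, <- !compA. f_equal.
        now rewrite (compA (sigma Q')), <- F_map_sigma_inj1.
    - apply (iso_cancel Iv0' (iso_id _)).
      rewrite comp_idr.
      rewrite E0. now apply iso_comp. }
  assert (IH : IsIso H).
  (* [H ∘ v] equals [v'] composed with the image of the isomorphism [u]; cancelling [v] leaves
     [H]. *)
  { apply (iso_cancel (iso_id _) Iv). rewrite comp_idl, <- E.
    exact (iso_comp Iv' (fmap_iso (T B) Iu)). }
  exact (proj1 (proj1 (Pt_iso H) IH)).
Qed.

(** * From (A1) and (A2) to an equivalence *)

Lemma unit_iso_of_kernels (P : Act B) :
  ActionsAreKernels -> IsIso (unit_map P).
Proof.
  intros A1. apply Act_iso; [|apply iso_id].
  (* By (A1), σι1 and κ are kernels of the same morphism; as κ is monic, their comparison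
     isomorphism is [unit_f P]. *)
  destruct (kernel_comparison_iso (A1 P) (kappa_kernel (T B P))) as [i [I E]].
  replace (act_f (unit_map P)) with i; [exact I|].
  apply (ker_mono (kappa_kernel (T B P))).
  exact (eq_trans E (eq_sym (kappa_unit_f P))).
Qed.

Lemma counit_iso_of_kernels (P : Pt B) :
  ActionsAreKernels -> SplitShortFiveLemma B -> IsIso (counit P).
Proof.
  intros A1 A2. apply Pt_iso. split; [|exact (iso_id (pt_cod P))].
  (* With σι1 as the kernel of the domain, supplied by (A1), and κ as that of the codomain, the
     counit induces identities on kernels and on bases. *)
  apply (A2 (T B (K P)) P _ _
    (sigma (K P) ∘ inj1 _ _ : hom _ (pt_dom (T B (K P)))) (kappa P)
    (idm _) (pt_f1 (counit P)) (pt_f0 (counit P))).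
  - exact (A1 (K P)).
  - apply kappa_kernel.
  - rewrite comp_idr. apply counit_sigma_inj1.
  - exact (counit_epi P).
  - exact (counit_sec P).
  - exact (iso_id (pt_cod P)).
  - apply iso_id.
Qed.

Lemma equivalence_of_kernels :
  ActionsAreKernels -> SplitShortFiveLemma B -> IsEquivalence (T B).
Proof.
  intros A1 A2. exists K. split.
  (* The unit runs from the identity to the composite, opposite to the direction in
     [IsEquivalence]. *)
  - apply NaturallyIsomorphic_sym. exists unit_map. split.
    + exact unit_natural.
    + intros P. now apply unit_iso_of_kernels.
  - exists counit. split.
    + exact counit_natural.
    + intros P. now apply counit_iso_of_kernels.
Qed.

End Adjunction.

Theorem theorem14 (B : PointedCategory)
  (HP : HasBinaryProducts B) (HC : HasBinaryCoproducts B)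
  (HK : HasSplitEpiKernels B) (HQ : HasReflexiveCoequalizers B) :
  IsEquivalence (T B) <->
  (forall P : Act B,
     IsKernel (sigma P ∘ inj1 (act_X P) (act_B P)) (zero_one_bar P)) /\
  SplitShortFiveLemma B.
Proof.
  split.
  - intros HT. split.
    + exact (actions_are_kernels_of_equivalence HT).
    + exact (split_short_five_of_equivalence HT).
  - intros [A1 A2]. exact (equivalence_of_kernels A1 A2).
Qed.
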